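(* Let $\Lambda$ be an artin algebra and let $\mathcal{C}$ be a functorially finite (full, additive) subcategory of $\mathrm{mod}\,\Lambda$, closed under direct summands and isomorphisms, which contains $\Lambda$ or $D\Lambda$. Let $f\in\mathrm{rad}_{\mathcal{C}}(A,B)$ be a nonzero morphism with $A,B\in\mathrm{ind}\,\mathcal{C}$. If $\mathcal{C}$ is of finite representation type, then $f$ is a sum of compositions of irreducible morphisms in $\mathcal{C}$ between indecomposable $\Lambda$-modules.
   Context: $\Lambda$ is an artin $R$-algebra over a commutative artinian ring $R$; $\mathrm{mod}\,\Lambda$ is the category of finitely generated left $\Lambda$-modules; $D=\mathrm{Hom}_R(-,I)$ with $I$ the injective envelope of $R/J_R$, $J_R$ the Jacobson radical of $R$. A left $\mathcal{C}$-approximation of $X\in\mathrm{mod}\,\Lambda$ is a morphism $\alpha:X\to C$ with $C\in\mathcal{C}$ such that every morphism $X\to C'$ with $C'\in\mathcal{C}$ factors through $\alpha$; right $\mathcal{C}$-approximations are dual. $\mathcal{C}$ is functorially finite if every $X\in\mathrm{mod}\,\Lambda$ has both a left and a right $\mathcal{C}$-approximation. $\mathrm{ind}\,\mathcal{C}$ is the full subcategory of indecomposable objects; $\mathcal{C}$ is of finite representation type if it has finitely many isomorphism classes of indecomposable objects. $\mathrm{rad}_{\mathcal{C}}(X,Y)=\{h\in\mathrm{Hom}_{\mathcal{C}}(X,Y) : 1_X-gh \text{ is invertible for all } g\in\mathrm{Hom}_{\mathcal{C}}(Y,X)\}$. A morphism $g:X\to Y$ in $\mathcal{C}$ is irreducible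 in $\mathcal{C}$ if it is neither a section nor a retraction and whenever $g=hf$ with $f:X\to Z$, $h:Z\to Y$ in $\mathcal{C}$, either $h$ is a retraction or $f$ is a section. *)

(* Defs.v *)
From HB Require Import structures.
From mathcomp Require Import all_boot all_order all_algebra.
From mathcomp Require Import boolp.

Set Implicit Arguments.
Unset Strict Implicit.
Unset Printing Implicit Defensive.

Import GRing.Theory.
Local Open Scope ring_scope.

Section Modules.
Variable S : nzRingType.
Implicit Types M N X Y I : lmodType S.

Definition finitely_generated M : Prop :=
  exists (n : nat) (e : 'I_n -> M),
    forall x, exists c : 'I_n -> S, x = \sum_i c i *: e i.

Definition zero_module M : Prop := forall x : M, x = 0.

Definition isomorphism M N (u : {linear M -> N}) : Prop :=
  exists v : {linear N -> M}, cancel u v /\ cancel v u.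

Definition isomorphic M N : Prop :=
  exists u : {linear M -> N}, isomorphism u.

Definition direct_summand X M : Prop :=
  exists Y, isomorphic M (X * Y)%type.

Definition indecomposable M : Prop :=
  ~ zero_module M /\
  forall X Y, isomorphic M (X * Y)%type -> zero_module X \/ zero_module Y.

Definition section X Y (f : {linear X -> Y}) : Prop :=
  exists g : {linear Y -> X}, forall x, g (f x) = x.

Definition retraction X Y (f : {linear X -> Y}) : Prop :=
  exists g : {linear Y -> X}, forall y, f (g y) = y.

Definition submodule M (P : M -> Prop) : Prop :=
  [/\ P 0, forall x y, P x -> P y -> P (x + y) & forall a x, P x -> P (a *: x)].

Definition injective_module I : Prop :=
  forall X Y (i : {linear X -> Y}) (f : {linear X -> I}), injective i ->
  exists g : {linear Y -> I}, forall x, g (i x) = f x.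

Definition essential_mono M N (e : {linear M -> N}) : Prop :=
  injective e /\
  forall P : N -> Prop, submodule P -> (exists2 y, P y & y <> 0) ->
  exists2 x, P (e x) & e x <> 0.

Definition injective_envelope M I (e : {linear M -> I}) : Prop :=
  injective_module I /\ essential_mono e.

(* q exhibits N as the quotient module M / P. *)
Definition quotient_map M N (P : M -> Prop) (q : {linear M -> N}) : Prop :=
  (forall z, exists x, q x = z) /\ (forall x, q x = 0 <-> P x).

End Modules.

Section Subcategories.
Variables (S : nzRingType) (C : lmodType S -> Prop).
Implicit Types M X Y Z : lmodType S.

(* A full additive subcategory of mod S, given by its class of objects. *)
Definition additive_subcategory : Prop :=
  [/\ forall M, C M -> finitely_generated M,
      forall M, zero_module M -> C M &
      forall X Y, C X -> C Y -> C (X * Y)%type].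

Definition closed_under_isomorphisms : Prop :=
  forall X Y, isomorphic X Y -> C X -> C Y.

Definition closed_under_summands : Prop :=
  forall X M, direct_summand X M -> C M -> C X.

Definition left_approximation X Y (alpha : {linear X -> Y}) : Prop :=
  C Y /\ forall Y', C Y' -> forall f : {linear X -> Y'},
    exists g : {linear Y -> Y'}, forall x, f x = g (alpha x).

Definition right_approximation Y X (alpha : {linear Y -> X}) : Prop :=
  C Y /\ forall Y', C Y' -> forall f : {linear Y' -> X},
    exists g : {linear Y' -> Y}, forall y, f y = alpha (g y).

Definition functorially_finite : Prop :=
  forall X, finitely_generated X ->
    (exists Y (alpha : {linear X -> Y}), left_approximation alpha) /\
    (exists Y (alpha : {linear Y -> X}), right_approximation alpha).

Definition ind X : Prop := C X /\ indecomposable X.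

Definition finite_representation_type : Prop :=
  exists (n : nat) (F : 'I_n -> lmodType S),
    (forall i, ind (F i)) /\ forall X, ind X -> exists i, isomorphic X (F i).

(* C is a full subcategory, so C constrains only the objects X and Y. *)
Definition radical X Y (h : {linear X -> Y}) : Prop :=
  [/\ C X, C Y &
      forall g : {linear Y -> X},
        isomorphism (idfun \- (g \o h) : {linear X -> X})].

Definition irreducible X Y (g : {linear X -> Y}) : Prop :=
  [/\ C X, C Y, ~ section g, ~ retraction g &
      forall Z (f : {linear X -> Z}) (h : {linear Z -> Y}), C Z ->
        (forall x, g x = h (f x)) -> retraction h \/ section f].

Inductive irreducible_composition :
    forall X Y, {linear X -> Y} -> Prop :=
| irrcomp_single X Y (g : {linear X -> Y}) :
    ind X -> ind Y -> irreducible g -> irreducible_composition g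
| irrcomp_comp X Y Z (g : {linear X -> Y}) (h : {linear Y -> Z}) :
    ind X -> ind Y -> irreducible g -> irreducible_composition h ->
    irreducible_composition (h \o g : {linear X -> Z}).

Definition sum_of_irreducible_compositions X Y (f : {linear X -> Y}) : Prop :=
  exists (n : nat) (u : 'I_n -> {linear X -> Y}),
    (forall i, irreducible_composition (u i)) /\
    forall x, f x = \sum_i u i x.

End Subcategories.

Section CommutativeRings.
Variable R : comNzRingType.

Definition ideal (J : R -> Prop) : Prop := @submodule R R^o J.

Definition artinian : Prop :=
  forall J : nat -> R -> Prop,
    (forall n, ideal (J n)) -> (forall n x, J n.+1 x -> J n x) ->
  exists N, forall n, (N <= n)%N -> forall x, J N x -> J n x.

Definition maximal_ideal (J : R -> Prop) : Prop :=
  [/\ ideal J, ~ J 1 &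
      forall K : R -> Prop, ideal K -> ~ K 1 -> (forall x, J x -> K x) ->
      forall x, K x -> J x].

Definition jacobson_radical : R -> Prop :=
  fun x => forall J, maximal_ideal J -> J x.

Definition envelope_of_R_mod_J (I : lmodType R) : Prop :=
  exists (Q : lmodType R) (q : {linear R^o -> Q}) (e : {linear Q -> I}),
    @quotient_map R R^o Q jacobson_radical q /\ injective_envelope e.

Definition artin_algebra (L : algType R) : Prop :=
  artinian /\ @finitely_generated R L.

End CommutativeRings.

(* Hom_R(L, I), a left L-module via (a . f)(x) = f (x a). *)
Definition dual (R : comNzRingType) (L : algType R) (I : lmodType R) : Type :=
  {linear L -> I}.

Section Dual.
Variables (R : comNzRingType) (L : algType R) (I : lmodType R).
Local Notation D := (dual L I).

Definition dual_fun (f : D) : {linear L -> I} := f.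

HB.instance Definition _ := gen_eqMixin D.
HB.instance Definition _ := gen_choiceMixin D.

Lemma dual_ext (f g : D) : dual_fun f =1 dual_fun g -> f = g.
Proof.
rewrite /dual_fun; case: f g => [f [[cf] [cf']]] [g [[cg] [cg']]] /funext /= fg.
subst g.
by rewrite (Prop_irrelevance cf cg) (Prop_irrelevance cf' cg').
Qed.

Definition dual_zero : D := (\0 : L -> I).
Definition dual_opp (f : D) : D := \- dual_fun f.
Definition dual_add (f g : D) : D := dual_fun f \+ dual_fun g.
Definition dual_scale (a : L) (f : D) : D := dual_fun f \o (a \o* @idfun L).

Lemma dual_addA : associative dual_add.
Proof. by move=> f g h; apply: dual_ext => x /=; rewrite addrA. Qed.

Lemma dual_addC : commutative dual_add.
Proof. by move=> f g; apply: dual_ext => x /=; rewrite addrC. Qed.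

Lemma dual_add0 : left_id dual_zero dual_add.
Proof. by move=> f; apply: dual_ext => x /=; rewrite add0r. Qed.

Lemma dual_addN : left_inverse dual_zero dual_opp dual_add.
Proof. by move=> f; apply: dual_ext => x /=; rewrite addNr. Qed.

HB.instance Definition _ :=
  GRing.isZmodule.Build D dual_addA dual_addC dual_add0 dual_addN.

Lemma dual_scaleA (a b : L) (f : D) :
  dual_scale a (dual_scale b f) = dual_scale (a * b) f.
Proof. by apply: dual_ext => x /=; rewrite mulrA. Qed.

Lemma dual_scale1 : left_id 1 dual_scale.
Proof. by move=> f; apply: dual_ext => x /=; rewrite mulr1. Qed.

Lemma dual_scaleDr : right_distributive dual_scale +%R.
Proof. by move=> a f g; apply: dual_ext. Qed.

Lemma dual_scaleDl (f : D) :
  {morph (fun a => dual_scale a f) : a b / a + b}.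
Proof. by move=> a b; apply: dual_ext => x /=; rewrite mulrDr raddfD. Qed.

HB.instance Definition _ := GRing.Zmodule_isLmodule.Build L D
  dual_scaleA dual_scale1 dual_scaleDr dual_scaleDl.

End Dual.

(* Main.v *)
(* A non-isomorphism f between indecomposable objects of C which is not
   irreducible is h g through some Z in C with g not a section and h not a
   retraction; decomposing Z into indecomposables, f becomes a sum of compositions of
   two non-isomorphisms between indecomposables of C.  Replacing the
   non-irreducible factors again and again, f is a sum of compositions of
   irreducible morphisms plus a sum of compositions of n non-isomorphisms, for
   every n.  Finite representation type bounds the lengths of the
   indecomposables, so by the Harada-Sai lemma the second sum vanishes for large
   n.  Lengths are finite because a commutative artinian ring has finite length
   (Akizuki). *)

Require Import Defs.
From HB Require Import structures.
From mathcomp Require Import all_boot all_order all_algebra.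
From mathcomp Require Import boolp classical_sets.
Import GRing.Theory.
Local Open Scope ring_scope.

Set Implicit Arguments.
Unset Strict Implicit.

(** * Relative length of submodules *)

Section Length.
Local Open Scope classical_set_scope.
Variable S : nzRingType.
Implicit Types M N : lmodType S.

Lemma submoduleB M (P : set M) : submodule P ->
  forall x y, P x -> P y -> P (x - y).
Proof. by move=> [_ PD PZ] x y Px Py; rewrite -scaleN1r; apply/PD/PZ. Qed.

Lemma submodule0 M : submodule [set (0 : M)].
Proof.
by split=> [//|x y -> ->|a x ->] /=; rewrite ?addr0 ?scaler0.
Qed.

Lemma submoduleT M : submodule [set: M].
Proof. by []. Qed.

Lemma submoduleI M (P Q : set M) :
  submodule P -> submodule Q -> submodule (P `&` Q).
Proof.
move=> [P0 PD PZ] [Q0 QD QZ]; split=> [//|x y [? ?] [? ?]|a x [? ?]].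
- by split; [apply: PD|apply: QD].
- by split; [apply: PZ|apply: QZ].
Qed.

Definition sum_set M (P Q : set M) : set M :=
  [set z | exists x y, [/\ P x, Q y & z = x + y]].

Lemma submoduleD M (P Q : set M) :
  submodule P -> submodule Q -> submodule (sum_set P Q).
Proof.
move=> [P0 PD PZ] [Q0 QD QZ]; split.
- by exists 0, 0; rewrite addr0.
- move=> _ _ [x [y [Px Qy ->]]] [x' [y' [Px' Qy' ->]]].
  by exists (x + x'), (y + y'); split; [exact: PD|exact: QD|rewrite addrACA].
- move=> a _ [x [y [Px Qy ->]]]; exists (a *: x), (a *: y).
  by split; [exact: PZ|exact: QZ|rewrite scalerDr].
Qed.

Lemma submodule_preim M N (f : {linear M -> N}) (P : set N) :
  submodule P -> submodule (f @^-1` P).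
Proof.
move=> [P0 PD PZ]; split=> [|x y|a x]; rewrite /preimage /= ?linear0 //.
- by rewrite linearD; apply: PD.
- by rewrite linearZ; apply: PZ.
Qed.

Lemma submodule_im M N (f : {linear M -> N}) (P : set M) :
  submodule P -> submodule (f @` P).
Proof.
move=> [P0 PD PZ]; split=> [|_ _ [x Px <-] [y Py <-]|a _ [x Px <-]].
- by exists 0; rewrite ?linear0.
- by exists (x + y); [exact: PD|rewrite linearD].
- by exists (a *: x); [exact: PZ|rewrite linearZ].
Qed.

Lemma not_subset M (P Q : set M) :
  ~ (P `<=` Q) -> exists2 x, P x & ~ Q x.
Proof. by move=> /existsNP[x /not_implyP[Px nQx]]; exists x. Qed.

(* The length of P above K is at least n.  Only the terms of the chain strictly
   below P are required to be submodules containing K. *)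
Fixpoint chain M (K : set M) (n : nat) (P : set M) : Prop :=
  if n is m.+1 then
    exists Q, [/\ submodule Q, K `<=` Q, Q `<` P & chain K m Q]
  else True.

(** By [chainW], one impossible length rules out all larger ones. *)
Definition finite_length M (K P : set M) := exists n, ~ chain K n P.

Lemma chain_sub M (K K' P P' : set M) n :
  K' `<=` K -> P `<=` P' -> chain K n P -> chain K' n P'.
Proof.
move=> KK; elim: n P P' => [//|n IHn] P P' PP' [Q [sQ KQ QP cQ]].
exists Q; split => //; [exact: subset_trans KQ| |exact: IHn cQ].
by case: QP => QP nPQ; split=> [|P'Q]; [|apply: nPQ]; apply: subset_trans; eassumption.
Qed.

Lemma chainW M (K P : set M) m n : (m <= n)%N -> chain K n P -> chain K m P.
Proof.
elim: m n P => [//|m IHm] [//|n] P; rewrite ltnS => mn [Q [? ? ? cQ]].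
by exists Q; split=> //; apply: IHm cQ.
Qed.

(* The modular law: a strict inclusion is visible on one of the two sides. *)
Lemma chain_split M (K N P : set M) n : submodule N -> submodule P ->
  K `<=` N -> chain K n P ->
  exists a b, [/\ n = (a + b)%N, chain K a (P `&` N) & chain N b (sum_set P N)].
Proof.
move=> sN sP KN; elim: n P sP => [|n IHn] P sP /=; first by exists 0%N, 0%N.
move=> [Q [sQ KQ [QP nPQ] cQ]].
have [a [b [-> ca cb]]] := IHn _ sQ cQ.
have sub_sum : sum_set Q N `<=` sum_set P N.
  by move=> _ [x [y [Qx Ny ->]]]; exists x, y; split=> //; apply: QP.
have [PN|nPN] := pselect (P `&` N `<=` Q `&` N); last first.
  exists a.+1, b; split=> //; last exact: chain_sub cb.
  exists (Q `&` N); split=> //; first exact: submoduleI.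
    by move=> x Kx; split; [exact: KQ|exact: KN].
  by split=> // x [Qx Nx]; split=> //; apply: QP.
exists a, b.+1; split; [by rewrite addnS|by apply: chain_sub ca => // x [/QP]|].
exists (sum_set Q N); split=> //; first exact: submoduleD.
  by move=> x Nx; exists 0, x; split=> //; [case: sQ|rewrite add0r].
(* Write [x = q + y] with [q] in [Q] and [y] in [N]. Then [y = x - q] lies in [P] and in [N], hence
   in [Q], and so does [x]. *)
split=> // PNQN; apply: nPQ => x Px.
have [|q [y [Qq Ny xE]]] := PNQN x.
  by exists x, 0; split=> //; [case: sN|rewrite addr0].
have [|Qy _] := PN y.
  split=> //; have -> : y = x - q by rewrite xE addrC addKr.
  by apply: submoduleB => //; apply: QP.
by rewrite xE; case: sQ => _ QD _; apply: QD.
Qed.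

Lemma chain_cat M (K N P : set M) a b : submodule N -> K `<=` N -> N `<=` P ->
  chain K a N -> chain N b P -> chain K (a + b) P.
Proof.
move=> sN KN; elim: b P => [|b IHb] P NP cN.
  by rewrite addn0 => _; apply: chain_sub cN.
move=> [Q [sQ NQ QP cQ]]; rewrite addnS; exists Q; split => //.
  exact: subset_trans NQ.
exact: IHb.
Qed.

Lemma finite_length_trans M (K N P : set M) : submodule N -> submodule P ->
  K `<=` N -> N `<=` P -> finite_length K N -> finite_length N P ->
  finite_length K P.
Proof.
move=> sN sP KN NP [a na] [b nb]; exists (a + b)%N => cP.
have [a' [b' [abE ca cb]]] := chain_split sN sP KN cP.
have {}ca : chain K a' N by apply: chain_sub ca => // x [].
have {}cb : chain N b' P.
  by apply: chain_sub cb => // _ [x [y [Px /NP Py ->]]]; case: sP => _ + _; apply.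
have [aa|aa] := leqP a a'; first exact/na/(chainW aa).
have [bb|bb] := leqP b b'; first exact/nb/(chainW bb).
have : (a' + b' < a + b)%N by rewrite -addSn leq_add // ltnW.
by rewrite abE ltnn.
Qed.

(** The hypothesis says that [T] maps onto [Q] modulo [K]. A point of [Q] outside the next term [P]
    therefore lifts to [T], and its lift avoids the preimage of [P] because [K] is inside [P];
    strict inclusions stay strict. *)
Lemma chain_preim M N (f : {linear M -> N}) (K Q : set N) (T : set M) n :
  submodule T -> submodule Q ->
  (forall q, Q q -> exists2 t, T t & K (q - f t)) ->
  chain K n Q -> chain (T `&` f @^-1` K) n (T `&` f @^-1` Q).
Proof.
move=> sT; elim: n Q => [//|n IHn] Q sQ QT [P [sP KP [PQ nQP] cP]].
exists (T `&` f @^-1` P); split.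
- by apply: submoduleI => //; apply: submodule_preim.
- by move=> x [Tx Kx]; split => //; apply: KP.
- split=> [x [Tx Px]|QP]; first by split=> //; apply: PQ.
  have [q Qq nPq] := not_subset nQP.
  have [t Tt Kt] := QT q Qq.
  have Qt : Q (f t).
    by rewrite -[f t](subKr q); apply: submoduleB => //; apply/PQ/KP.
  have [_ Pt] := QP t (conj Tt Qt).
  by apply: nPq; rewrite -[q](subrK (f t)); case: sP => _ + _; apply => //; apply: KP.
- by apply: IHn => // q /PQ; apply: QT.
Qed.

(** On [P] the kernel of [f] lies in [K], hence in every term of the chain, so distinct terms have
    distinct images. *)
Lemma chain_im M N (f : {linear M -> N}) (K P : set M) n :
  submodule P -> (forall x, P x -> f x = 0 -> K x) ->
  chain K n P -> chain [set 0] n (f @` P).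
Proof.
elim: n P => [//|n IHn] P sP PK [Q [sQ KQ [QP nPQ] cQ]].
exists (f @` Q); split.
- exact: submodule_im.
- by move=> _ ->; exists 0; rewrite ?linear0 //; case: sQ.
- split=> [_ [x /QP Px <-]|PQ]; first by exists x.
  apply: nPQ => x Px.
  have [|y Qy yx] := PQ (f x); first by exists x.
  rewrite -[x](subrK y); case: sQ => _ + _; apply => //; apply/KQ/PK.
    by apply: submoduleB => //; apply: QP.
  by rewrite linearB yx subrr.
- by apply: IHn => // x /QP; apply: PK.
Qed.

Lemma chain_surj M N (f : {linear M -> N}) (T : set M) n : submodule T ->
  chain [set 0] n (f @` T) -> chain [set 0] n T.
Proof.
move=> sT /(@chain_preim _ _ f _ _ T) c.
have {}c : chain (T `&` f @^-1` [set 0]) n (T `&` f @^-1` (f @` T)).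
  by apply: c => //; [exact: submodule_im|move=> _ [t Tt <-]; exists t; rewrite //= subrr].
by apply: chain_sub c => [_ ->|x []//]; split; rewrite /preimage /= ?linear0 //; case: sT.
Qed.

(** The chain pulled back along [f] stays above the kernel of [f] in [T]. This kernel contains [x],
    so the step from zero to it is one more strict inclusion. *)
Lemma chain_noninj M N (f : {linear M -> N}) (T : set M) n x : submodule T ->
  T x -> f x = 0 -> x <> 0 -> chain [set 0] n (f @` T) -> chain [set 0] n.+1 T.
Proof.
move=> sT Tx fx0 x0 /(@chain_preim _ _ f _ _ T) c.
have {}c : chain (T `&` f @^-1` [set 0]) n (T `&` f @^-1` (f @` T)).
  by apply: c => //; [exact: submodule_im|move=> _ [t Tt <-]; exists t; rewrite //= subrr].
have T0 : T 0 by case: sT.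
rewrite -add1n; apply: chain_cat (chain_sub (@subset_refl _ _) _ c).
- by apply/submoduleI/submodule_preim/submodule0.
- by move=> _ ->; split; rewrite /preimage /= ?linear0.
- by move=> y [].
- exists [set 0]; split=> //; first exact: submodule0.
  split=> [_ ->|/(_ x)]; first by split; rewrite /preimage /= ?linear0.
  by move=> kx; apply: x0; apply: kx.
- by move=> y [].
Qed.

End Length.

(** * Finitely generated modules over artin algebras *)

Section FinitelyGenerated.
Local Open Scope classical_set_scope.

Definition mk_linear (S : nzRingType) (M N : lmodType S) (f : M -> N)
  (f_lin : linear f) : {linear M -> N} :=
  HB.pack f (GRing.isLinear.Build _ _ _ _ f f_lin).

Definition finite_length_module (S : nzRingType) (M : lmodType S) :=
  finite_length [set (0 : M)] setT.

Lemma scale_linear (S : nzRingType) (M : lmodType S) (x : M) :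
  linear (fun r : S^o => r *: x).
Proof. by move=> a r s; rewrite scalerDl -scalerA. Qed.

Lemma finitely_generated_finite_length (S : nzRingType) (M : lmodType S) :
  finite_length_module S^o -> finitely_generated M -> finite_length_module M.
Proof.
move=> flS [n [e genM]].
pose span m (e : 'I_m -> M) :=
  [set x | exists c : 'I_m -> S, x = \sum_i c i *: e i].
have sspan m (g : 'I_m -> M) : submodule (span m g).
  split=> [|_ _ [c ->] [d ->]|a _ [c ->]].
  - by exists (fun=> 0); rewrite big1 // => i _; rewrite scale0r.
  - exists (fun i => c i + d i); rewrite -big_split /=.
    by apply: eq_bigr => i _; rewrite scalerDl.
  - by exists (fun i => a * c i); rewrite scaler_sumr; apply: eq_bigr => i _; rewrite scalerA.
suff [k nk] : finite_length [set 0] (span n e).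
  by exists k => ck; apply: nk; apply: chain_sub ck => // x _; apply: genM.
(* Induction on the number of generators: each new generator enlarges the span by a cyclic
   quotient. *)
elim: n e {genM} => [|n IHn] e.
  exists 1%N => -[Q [[Q0 _ _] _ [_ +] _]]; apply=> _ [c ->].
  by rewrite big_ord0.
pose e' i := e (widen_ord (leqnSn n) i).
have subE : span n e' `<=` span n.+1 e.
  move=> _ [c ->]; exists (fun i => if unlift ord_max i is Some j then c j else 0).
  rewrite big_ord_recr /= unlift_none scale0r addr0; apply: eq_bigr => i _.
  have -> : widen_ord (leqnSn n) i = lift ord_max i.
    by apply: val_inj; rewrite /= /bump leqNgt ltn_ord.
  rewrite liftK; congr (_ *: e _).
  by apply: val_inj; rewrite /= /bump leqNgt ltn_ord.
apply: finite_length_trans (IHn e') _ => //.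
  by move=> _ ->; case: (sspan n e').
have [k nk] := flS; exists k => ck; apply: nk.
(* Multiples of the last generator cover the larger span modulo the smaller one, so chains between
   the two spans pull back to the ring. *)
pose f := mk_linear (scale_linear (e ord_max)).
suff ck' : chain (setT `&` f @^-1` span n e') k (setT `&` f @^-1` span n.+1 e).
  apply: chain_sub ck' => // _ ->; split=> //; rewrite /preimage /= scale0r.
  by case: (sspan n e').
apply: chain_preim => // _ [c ->]; exists (c ord_max) => //=.
by rewrite big_ord_recr /= addrK; exists (fun i => c (widen_ord (leqnSn n) i)).
Qed.

(** * Finite length of commutative artinian rings *)

Section Akizuki.
Variable R : comNzRingType.
Hypothesis artR : artinian R.

Lemma mulr_linear (r : R) : linear (fun x : R^o => r * x : R^o).
Proof. by move=> a x y; rewrite mulrDr mulrCA. Qed.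

(** Without a minimal member, choice would iterate to a strictly descending sequence of ideals. *)
Lemma artinian_minimal_ideal (T : set (set R)) :
  T `<=` ideal (R := R) -> T !=set0 ->
  exists2 I, T I & forall J, T J -> J `<` I -> False.
Proof.
move=> Tid [I0 TI0]; apply: contrapT => nmin.
have next (I : {I | T I}) : exists J : {J | T J}, sval J `<` sval I.
  case: I => I TI; apply: contrapT => nJ; apply: nmin; exists I => // J TJ JI.
  by apply: nJ; exists (exist _ J TJ).
have [nxt nxtP] := choice next.
pose c n := iter n nxt (exist _ I0 TI0).
have [n|n x|N cN] := artR (J := fun n => sval (c n)).
- exact: (Tid _ (svalP (c n))).
- exact: (nxtP (c n)).1.
- by case: (nxtP (c N)) => _; apply => x; apply: (cN N.+1 (leqnSn N)).
Qed.

Lemma sum_line_submodule (K : set R^o) x : submodule K ->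
  submodule [set z | exists k r, K k /\ z = k + r * x].
Proof.
move=> [K0 KD KZ]; split.
- by exists 0, 0; rewrite mul0r addr0.
- move=> _ _ [k [r [Kk ->]]] [k' [r' [Kk' ->]]]; exists (k + k'), (r + r').
  by split; [exact: KD|rewrite mulrDl addrACA].
- move=> a _ [k [r [Kk ->]]]; exists (a * k), (a * r).
  by split; [exact: KZ|rewrite scalerDr /= -mulrA].
Qed.

(** Take [I] minimal among the ideals of infinite length. Every scalar acts on [I] as zero or
    invertibly, so [I] is like a vector space over a field. A submodule [K] of [I] maximal among
    those avoiding a nonzero [x] has finite length by minimality, and [I] has length at most one
    above [K]: a contradiction. *)
Lemma artinian_finite_length : finite_length_module R^o.
Proof.
apply: contrapT => nflR.
pose T : set (set R) := [set I | @ideal R I /\ ~ @finite_length R R^o [set 0] I].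
have [||I [sI nflI] minI] := @artinian_minimal_ideal T.
- by move=> J [].
- by exists setT; split => //; apply: submoduleT.
have {}minI J : submodule (J : set R^o) -> J `<` I -> finite_length [set (0:R^o)] J.
  by move=> sJ JI; apply: contrapT => nflJ; apply: (minI J).
have I0 : I 0 by case: sI.
have IZ r x : I x -> I (r * x) by case: sI => _ _; apply.
(* Otherwise the kernel and the image of multiplication by [r] on [I] are both proper in [I], hence
   of finite length, and so would be [I]. *)
have dich r : (forall x, I x -> r * x = 0) \/
    (forall y, I y -> exists2 x, I x & y = r * x).
  apply: contrapT => /not_orP[r0 rI]; apply: nflI.
  pose f := mk_linear (mulr_linear r).
  have sN : @submodule R R^o (I `&` f @^-1` [set 0]).
    exact/submoduleI/submodule_preim/submodule0.
  apply: (@finite_length_trans R R^o _ (I `&` f @^-1` [set 0])) => //.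
  - by move=> _ ->; split; rewrite /preimage /= ?mulr0.
  - apply: minI => //; split=> [x []//|IN].
    by apply: r0 => x /IN[].
  - have [|k nk] := minI (f @` I) (submodule_im f sI).
      split=> [_ [x Ix <-]|II]; first exact: IZ.
      by apply: rI => y /II[x Ix <-]; exists x.
    by exists k => /chain_im -/(_ _ f) c; apply: nk; apply: c.
have inv r : ~ (forall x, I x -> r * x = 0) ->
    exists s, forall x, I x -> x = s * (r * x).
  move=> r0; have rI : forall y, I y -> exists2 x, I x & y = r * x.
    by case: (dich r).
  (* The ideals generated by [r ^+ n] and the annihilator of [I] stabilise, so
     [r ^+ N = r ^+ N.+1 * b + p] with [p] killing [I]. Since [r ^+ N] maps [I] onto itself, [b]
     inverts [r] on [I]. *)
  pose J n := [set a | exists b p, (forall x, I x -> p * x = 0) /\ a = r ^+ n * b + p].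
  have [n|n|N JN] := artR (J := J).
  - split.
    + by exists 0, 0; split=> [x _|]; rewrite ?mul0r // mulr0 addr0.
    + move=> _ _ [b [p [p0 ->]]] [b' [p' [p'0 ->]]]; exists (b + b'), (p + p').
      split=> [x Ix|]; first by rewrite mulrDl p0 // p'0 // addr0.
      by rewrite mulrDr addrACA.
    + move=> a _ [b [p [p0 ->]]]; exists (a * b), (a * p).
      split=> [x Ix|]; first by rewrite -mulrA p0 // mulr0.
      by rewrite scalerDr /GRing.scale /= mulrCA.
  - by move=> _ [b [p [p0 ->]]]; exists (r * b), p; split; rewrite // exprSr mulrA.
  - have [|b [p [p0 rE]]] := JN N.+1 (leqnSn N) (r ^+ N).
      by exists 1, 0; split=> [x _|]; rewrite ?mul0r // mulr1 addr0.
    have rnI n y : I y -> exists2 x, I x & y = r ^+ n * x.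
      elim: n y => [|n IHn] y Iy; first by exists y; rewrite ?mul1r.
      have [x Ix ->] := rI y Iy; have [z Iz ->] := IHn x Ix.
      by exists z; rewrite // exprS mulrA.
    exists b => x /(rnI N)[y Iy ->].
    by rewrite {1}rE mulrDl p0 // addr0 [r * (_ * _)]mulrA -exprS [_ * b]mulrC mulrA.
have [x Ix x0] : exists2 x, I x & x <> 0.
  apply: contrapT => I0'; apply: nflI; exists 1%N => -[Q [[Q0 _ _] _ [_ +] _]].
  apply=> x Ix; suff -> : x = 0 by [].
  by apply: contrapT => x0; apply: I0'; exists x.
(* Zero is adjoined because the union of the empty chain, which Zorn's lemma also requires, is the
   empty set. *)
pose avoid := [set K : set R | [/\ @submodule R R^o (K `|` [set (0 : R^o)]), K `<=` I & ~ K x]].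
have [F Fav Ftot|A [[sA AI nAx] maxA]] := @Zorn_bigcup _ avoid.
  split.
  - split; first by right.
    + move=> u v [[P FP Pu]|->]; last by rewrite add0r.
      move=> [[Q FQ Qv]|->]; last by rewrite addr0; left; exists P.
      have [PQ|QP] := Ftot P Q FP FQ.
        have [[_ QD _] _ _] := Fav Q FQ.
        have [] := QD u v; [by left; apply: PQ|by left| |by right].
        by left; exists Q.
      have [[_ PD _] _ _] := Fav P FP.
      have [] := PD u v; [by left|by left; apply: QP| |by right].
      by left; exists P.
    + move=> a u [[P FP Pu]|->]; last by rewrite scaler0; right.
      have [[_ _ PZ] _ _] := Fav P FP.
      have [] := PZ a u; [by left| |by right].
      by left; exists P.
  - by move=> u [P FP Pu]; case: (Fav P FP) => _ PI _; apply: PI.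
  - by move=> [P FP Px]; case: (Fav P FP).
pose K : set R^o := A `|` [set 0].
have KI : K `<=` I by move=> u [/AI//|->].
have nKx : ~ K x by move=> [].
(* Every submodule of I properly containing K contains x. *)
have maxK Q : submodule (Q : set R^o) -> K `<` Q -> Q `<=` I -> Q x.
  move=> sQ [KQ nQK] QI; apply: contrapT => nQx; apply: (maxA Q).
    split=> [u Au|QA]; first by apply: KQ; left.
    by apply: nQK => u /QA; left.
  split=> //; suff -> : Q `|` [set (0 : R^o)] = Q by [].
  by rewrite setUidl // => _ ->; apply: KQ; right.
apply: nflI; apply: (@finite_length_trans R R^o _ K) => //.
- by move=> _ ->; right.
- by apply: minI => //; split=> // IK; apply/nKx/IK.
(* A chain of length two puts a [Q] strictly between [K] and [I]. For [y] in [I] outside [K],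
   [x = k + r * y] with [r] invertible on [I]; as [x] and [k] lie in [Q], so does [y]. *)
- exists 2%N => -[Q [sQ KQ [QI nIQ] [K' [sK' KK' [K'Q nQK'] _]]]].
  have Qx : Q x.
    apply: maxK => //; split=> // QK; apply: nQK' => u /QK; exact: KK'.
  apply: nIQ => y Iy.
  have [Ky|nKy] := pselect (K y); first exact: KQ.
  have [|||k [r [Kk xE]]] := maxK [set z | exists k r, K k /\ z = k + r * y].
  - exact: sum_line_submodule.
  - split=> [u Ku|yK]; first by exists u, 0; rewrite mul0r addr0.
    apply: nKy; apply: yK; exists 0, 1; rewrite mul1r add0r; split=> //; by right.
  - move=> _ [k [r [Kk ->]]]; case: sI => _ ID _; apply: ID; [exact: KI|exact: IZ].
  have [|s /(_ y Iy) ->] := inv r.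
    by move=> r0; apply: nKx; rewrite xE r0 // addr0.
  have -> : r * y = x - k by rewrite xE addrC addKr.
  case: (sQ) => _ _ QZ; apply: (QZ s); apply: (submoduleB sQ) => //; exact: KQ.
Qed.

End Akizuki.

(** Left ideals of [L] are [R]-submodules, so chains of them are bounded by the length of [L] over
    [R]. *)
Lemma artin_algebra_finite_length (R : comNzRingType) (L : algType R)
  (M : lmodType L) : artin_algebra L -> finitely_generated M ->
  finite_length_module M.
Proof.
move=> [artR fgL]; apply: finitely_generated_finite_length.
have [n nn] := finitely_generated_finite_length (artinian_finite_length artR) fgL.
exists n => cn; apply: nn; elim: n [set: L^o] cn => [//|n IHn] P [Q [sQ Q0 QP cQ]].
exists Q; split=> //; last exact: IHn.
case: sQ => ? ? QZ; split=> // a x Qx.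
by have := QZ a%:A x Qx; rewrite /GRing.scale /= -scalerAl mul1r.
Qed.

End FinitelyGenerated.

(** * Decompositions *)

Section SubmoduleType.
Variables (S : nzRingType) (M : lmodType S) (P : M -> Prop).
Hypothesis sP : submodule P.

Definition submodule_pred : pred M := fun x => `[< P x >].

Lemma submodule_pred_closed : GRing.subsemimod_closed submodule_pred.
Proof.
case: sP => P0 PD PZ; split; first split.
- exact/asboolP.
- by move=> x y /asboolP Px /asboolP Py; apply/asboolP/PD.
- by move=> a x /asboolP Px; apply/asboolP/PZ.
Qed.

(* The proof sP is an argument of the type so that its module structure can be
   inferred. *)
Definition submodule_type (_ : submodule P) := {x : M | submodule_pred x}.

HB.instance Definition _ := [Choice of submodule_type sP by <:].
HB.instance Definition _ := SubType.copy (submodule_type sP) {x : M | submodule_pred x}.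
HB.instance Definition _ :=
  GRing.SubChoice_isSubLmodule.Build S M submodule_pred (submodule_type sP)
    submodule_pred_closed.

End SubmoduleType.

Section LinearMaps.
Variable S : nzRingType.
Implicit Types X Y Z : lmodType S.

Lemma linear_ext X Y (f g : {linear X -> Y}) : f =1 g -> f = g.
Proof.
case: f g => [f [[cf] [cf']]] [g [[cg] [cg']]] /funext /= fg.
subst g.
by rewrite (Prop_irrelevance cf cg) (Prop_irrelevance cf' cg').
Qed.

Lemma bijective_isomorphism X Y (f : {linear X -> Y}) :
  injective f -> (forall y, exists x, f x = y) -> isomorphism f.
Proof.
move=> finj /choice[g fgK].
have g_lin : linear g by move=> a x y; apply: finj; rewrite linearP !fgK.
by exists (mk_linear g_lin); split=> // x; apply: finj; rewrite /= fgK.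
Qed.

Lemma pair_linear X Y Z (f : {linear Z -> X}) (g : {linear Z -> Y}) :
  linear (fun z => (f z, g z)).
Proof. by move=> a x y; rewrite !linearP. Qed.

Lemma indecomposable_direct_sum X (P Q : X -> Prop) :
  indecomposable X -> submodule P -> submodule Q ->
  (forall x, P x -> Q x -> x = 0) -> (forall x, sum_set P Q x) ->
  (forall x, P x -> x = 0) \/ (forall x, Q x -> x = 0).
Proof.
move=> [_ indX] sP sQ PQ0 PQ.
have v_lin : linear (fun z : (submodule_type sP * submodule_type sQ)%type =>
    \val z.1 + \val z.2 : X).
  by move=> a [x y] [x' y']; rewrite !linearP /= scalerDr addrACA.
have predP (R : X -> Prop) (sR : submodule R) (x : submodule_type sR) : R (\val x).
  exact/asboolP/(valP x).
have [|x|u [uK vK]] := @bijective_isomorphism _ _ (mk_linear v_lin).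
- apply: raddf_inj => -[x y] /= xy0.
  have x0 : \val x = 0.
    apply: PQ0; first exact: predP.
    have -> : \val x = 0 - \val y by apply/eqP; rewrite sub0r -addr_eq0; apply/eqP.
    by apply: submoduleB => //; [case: (sQ)|apply: predP].
  by congr pair; apply: val_inj => //; rewrite /= -[RHS]xy0 [sval x]x0 add0r.
- have [p [q [Pp Qq ->]]] := PQ x.
  by exists (Sub p (introT (asboolP _) Pp), Sub q (introT (asboolP _) Qq)).
have [|X0|Y0] := indX (submodule_type sP) (submodule_type sQ).
- by exists u, (mk_linear v_lin).
- left=> x Px; have := X0 (Sub x (introT (asboolP _) Px)).
  by move=> /(congr1 val).
- right=> x Px; have := Y0 (Sub x (introT (asboolP _) Px)).
  by move=> /(congr1 val).
Qed.

(** [Y] is the direct sum of the image of [s], which is nonzero, and the kernel of [r], which must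
    vanish; it contains every [y - s (r y)]. *)
Lemma split_mono_isomorphism X Y (s : {linear X -> Y}) (r : {linear Y -> X}) :
  indecomposable Y -> ~ zero_module X -> (forall x, r (s x) = x) ->
  cancel r s.
Proof.
move=> indY nX0 rs.
pose P y := exists x, y = s x; pose Q y := r y = 0.
have [||||P0|Q0] := @indecomposable_direct_sum Y P Q indY.
- split=> [|_ _ [x ->] [x' ->]|a _ [x ->]].
  + by exists 0; rewrite linear0.
  + by exists (x + x'); rewrite linearD.
  + by exists (a *: x); rewrite linearZ.
- split=> [|x y x0 y0|a x x0]; rewrite /Q ?linear0 //.
  + by rewrite linearD x0 y0 addr0.
  + by rewrite linearZ /= x0 scaler0.
- by move=> _ [x ->]; rewrite /Q rs => ->; rewrite linear0.
- move=> y; exists (s (r y)), (y - s (r y)); split; first by exists (r y).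
    by rewrite /Q linearB rs subrr.
  by rewrite addrC subrK.
- by case: nX0 => x; rewrite -[x]rs [s x]P0 ?linear0 //; exists x.
- by move=> y; apply/esym/eqP; rewrite -subr_eq0; apply/eqP/Q0; rewrite /Q linearB rs subrr.
Qed.

End LinearMaps.

(** * Compositions of non-isomorphisms *)

Section Paths.
Variables (S : nzRingType) (C : lmodType S -> Prop).
Implicit Types X Y Z : lmodType S.

Inductive noniso_path : nat -> forall X Y, {linear X -> Y} -> Prop :=
| noniso_path_id X : ind C X -> noniso_path 0 (idfun : {linear X -> X})
| noniso_path_cons n X Y Z (g : {linear X -> Y}) (h : {linear Y -> Z}) :
    ind C X -> ~ isomorphism g -> noniso_path n h ->
    noniso_path n.+1 (h \o g : {linear X -> Z}).

Lemma noniso_path_ends n X Y (f : {linear X -> Y}) :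
  noniso_path n f -> ind C X /\ ind C Y.
Proof. by elim=> [|m U V W g h iU _ _ []]. Qed.

Lemma noniso_path1 X Y (f : {linear X -> Y}) :
  ind C X -> ind C Y -> ~ isomorphism f -> noniso_path 1 f.
Proof.
move=> iX iY nf.
have -> : f = (idfun : {linear Y -> Y}) \o f :> {linear X -> Y} by exact: linear_ext.
exact/noniso_path_cons/noniso_path_id.
Qed.

Lemma noniso_path_cat a b X Y Z (g : {linear X -> Y}) (h : {linear Y -> Z}) :
  noniso_path a g -> noniso_path b h ->
  noniso_path (a + b) (h \o g : {linear X -> Z}).
Proof.
move=> pg; elim: pg Z h => [U _ Z h ph|n U W V u v iU nu _ IH Z h ph].
  by have -> : h \o idfun = h :> {linear U -> Z} by exact: linear_ext.
have -> : h \o (v \o u) = (h \o v) \o u :> {linear U -> Z} by exact: linear_ext.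
by apply: noniso_path_cons => //; apply: IH.
Qed.

Lemma noniso_path_split n a b X Z (f : {linear X -> Z}) :
  noniso_path n f -> n = (a + b)%N ->
  exists Y (g : {linear X -> Y}) (h : {linear Y -> Z}),
    [/\ f = h \o g :> {linear X -> Z}, noniso_path a g & noniso_path b h].
Proof.
move=> pf; elim: pf a => [U iU|m U W V u v iU nu pv IH] [|a] // nE.
- rewrite -[b]nE; exists U, idfun, idfun.
  by split; [exact: linear_ext|exact: noniso_path_id..].
- exists U, idfun, (v \o u); split; [exact: linear_ext|exact: noniso_path_id|].
  by rewrite -[b]nE; apply: noniso_path_cons.
- case: nE => /IH[Y [g [h [-> pg ph]]]].
  exists Y, (g \o u), h.
  by split; [exact: linear_ext|exact: noniso_path_cons|].
Qed.

Lemma isomorphism_id X : isomorphism (idfun : {linear X -> X}).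
Proof. by exists idfun. Qed.

Lemma noniso_path_noniso X Y (f : {linear X -> Y}) :
  noniso_path 1 f -> ~ isomorphism f.
Proof.
have path0_iso n (U V : lmodType S) (h : {linear U -> V}) : noniso_path n h -> n = 0%N -> isomorphism h.
  by case=> // *; apply: isomorphism_id.
suff path_noniso n : noniso_path n f -> n = 1%N -> ~ isomorphism f.
  by move=> /path_noniso; apply.
case=> // m U W V g h _ ng /path0_iso + [m0] => /(_ m0) [h' [hK h'K]].
move=> [k [kK k'K]]; apply: ng; exists (k \o h).
split=> x; first exact: kK.
by apply: (can_inj hK); rewrite /= [LHS]k'K.
Qed.

(** * The Harada-Sai lemma *)

Section HaradaSai.
Local Open Scope classical_set_scope.
Variable b : nat.
Hypothesis b_bound : forall X, ind C X -> ~ chain [set (0 : X)] b setT.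

(* The range of the composition of 2^k - 1 non-isomorphisms has length less than
   b - k: if three such ranges, for f, h and h g f, had the same length, the
   modules around the middle map g would split as range f + ker (h g) and
   range (g f) + ker h, and g would be bijective. *)
Lemma harada_sai_range k : (k < b)%N -> forall X Y (f : {linear X -> Y}),
  noniso_path (2 ^ k).-1 f -> ~ chain [set 0] (b - k) (range f).
Proof.
elim: k => [|k IHk] kb X Y F pF.
  have [iX _] := noniso_path_ends pF.
  by rewrite subn0 => /chain_surj c; apply: (b_bound iX); apply: c.
have kE : (2 ^ k.+1).-1 = ((2 ^ k).-1 + (1 + (2 ^ k).-1))%N.
  by rewrite expnS; have := expn_gt0 2 k; case: (2 ^ k)%N => // m _; rewrite mul2n -addnn add1n.
have [V [f [gh [-> pf pgh]]]] := noniso_path_split pF kE.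
have [W [g [h [-> pg ph]]]] := noniso_path_split pgh erefl.
have ng := noniso_path_noniso pg.
have [[_ indV] [_ indW]] := noniso_path_ends pg.
have kb' := ltnW kb.
have cf := IHk kb' _ _ _ pf; have ch := IHk kb' _ _ _ ph.
have bkE : (b - k = (b - k.+1).+1)%N by rewrite subnSK.
(* With [m = b - k.+1], the ranges of [f] and [h] have length at most [m], while the range of the
   whole composition is assumed to have length at least [m], and [m] is positive. *)
rewrite bkE in cf ch.
have bk0 : (0 < b - k.+1)%N by rewrite subn_gt0.
move: (b - k.+1)%N bk0 cf ch => m m0 cf ch cF.
have srange (U U' : lmodType S) (u : {linear U -> U'}) : submodule (range u).
  exact/submodule_im/submoduleT.
have sker (U U' : lmodType S) (u : {linear U -> U'}) : submodule (u @^-1` [set 0]).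
  exact/submodule_preim/submodule0.
have F0 : ~ forall x, h (g (f x)) = 0.
  move=> F0; have [Q [[Q0 _ _] _ [_ nQ] _]] := chainW m0 cF.
  by apply: nQ => _ [x _ <-]; rewrite /= F0.
(* Were the range of the composition strictly inside that of [h], the latter would have a chain of
   length [m.+1]. *)
have hF w : exists u, h w = h (g (f u)).
  have [u _ <-] : range ((h \o g) \o f) (h w); last by exists u.
  apply: contrapT => nFw; apply: ch; exists (range ((h \o g) \o f)); split.
  - exact: (srange _ _ ((h \o g) \o f : {linear X -> Y})).
  - by move=> _ ->; exists 0; rewrite ?linear0.
  - by split=> [_ [u _ <-]|/(_ (h w))]; [exists (g (f u))|move=> hw; apply/nFw/hw; exists w].
  - exact: cF.
have gfE : range (g \o f) = g @` range f.
  by rewrite image_comp.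
have FE : range ((h \o g) \o f) = (h \o g) @` range f.
  by rewrite image_comp.
have FE' : range ((h \o g) \o f) = h @` range (g \o f).
  by rewrite image_comp.
have cgf : ~ chain [set 0] m.+1 (range (g \o f)).
  by rewrite gfE => c; apply: cf; apply: chain_surj c.
(* A nonzero kernel element of [h \o g] in the range of [f] would lengthen the chain there. The
   range of [f] is nonzero, so this kernel is zero and [g] is injective. *)
have [||||f0|g0] :=
    @indecomposable_direct_sum _ V (range f) ((h \o g) @^-1` [set 0]) indV.
- exact: srange.
- exact: (sker _ _ (h \o g : {linear V -> Y})).
- move=> x fx hgx; apply: contrapT => x0; apply: cf.
  apply: (@chain_noninj _ _ _ (h \o g : {linear V -> Y}) _ _ x) => //.
  by rewrite -FE.
- move=> x; have [u xu] := hF (g x).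
  exists (f u), (x - f u); split; [by exists u| |by rewrite addrC subrK].
  by rewrite /preimage /= !linearB xu subrr.
- by apply: F0 => x; rewrite (f0 (f x)) ?linear0 //; exists x.
(* In the same way [h] is injective, and [hF] then makes [g] surjective. *)
have [||||gf0|h0] :=
    @indecomposable_direct_sum _ W (range (g \o f)) (h @^-1` [set 0]) indW.
- exact: (srange _ _ (g \o f : {linear X -> W})).
- exact: sker.
- move=> x fx hx; apply: contrapT => x0; apply: cgf.
  apply: (@chain_noninj _ _ _ h (range (g \o f)) m x) => //.
    exact: (srange _ _ (g \o f : {linear X -> W})).
  by move: cF; rewrite FE'.
- move=> w; have [u wu] := hF w.
  exists (g (f u)), (w - g (f u)); split; [by exists u| |by rewrite addrC subrK].
  by rewrite /preimage /= linearB wu subrr.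
- by apply: F0 => x; rewrite (gf0 (g (f x))) ?linear0 //; exists x.
apply: ng; apply: bijective_isomorphism.
- by apply: raddf_inj => x gx0; apply: g0; rewrite /preimage /= gx0 linear0.
- move=> w; have [u wu] := hF w; exists (f u); apply/esym/eqP.
  by rewrite -subr_eq0; apply/eqP/h0; rewrite /preimage /= linearB wu subrr.
Qed.

Lemma harada_sai n X Y (f : {linear X -> Y}) :
  noniso_path n f -> ((2 ^ b.-1).-1 <= n)%N -> forall x, f x = 0.
Proof.
move=> pf nb x.
have [iX _] := noniso_path_ends pf.
have b0 : (0 < b)%N by case: b (b_bound iX) => // nc; case: nc.
have [Z [g [h [-> pg _]]]] := noniso_path_split pf (esym (subnKC nb)).
suff gx0 : g x = 0 by rewrite /= gx0 linear0.
(* For [k = b.-1] the range of [g] has no chain of length one, so it is zero. *)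
have kb : (b.-1 < b)%N by rewrite prednK.
apply: contrapT => gx0; apply: (harada_sai_range kb pg).
rewrite -{1}(prednK b0) subSn // subnn; exists [set 0]; split=> //.
  exact: submodule0.
split=> [_ ->|/(_ (g x)) g0]; first by exists 0; rewrite ?linear0.
by apply: gx0; apply: g0; exists x.
Qed.

End HaradaSai.

(** * Finite sums of morphisms, in a form suited to refining the summands *)

Inductive add_closure X Y (P : {linear X -> Y} -> Prop) : {linear X -> Y} -> Prop :=
| add_closure0 : add_closure P (\0 : {linear X -> Y})
| add_closureS (u v : {linear X -> Y}) :
    P u -> add_closure P v -> add_closure P (u \+ v : {linear X -> Y}).

Lemma add_closure_ext X Y (P : {linear X -> Y} -> Prop) (f g : {linear X -> Y}) :
  f =1 g -> add_closure P f -> add_closure P g.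
Proof. by move=> /linear_ext->. Qed.

Lemma add_closure_eq0 X Y (P : {linear X -> Y} -> Prop) (f : {linear X -> Y}) :
  (forall x, f x = 0) -> add_closure P f.
Proof.
move=> f0; have -> : f = \0 :> {linear X -> Y} by exact: linear_ext.
exact: add_closure0.
Qed.

Lemma add_closure_incl X Y (P : {linear X -> Y} -> Prop) u : P u -> add_closure P u.
Proof.
move=> Pu; have -> : u = u \+ \0 :> {linear X -> Y}.
  by apply: linear_ext => x /=; rewrite addr0.
exact/add_closureS/add_closure0.
Qed.

Lemma add_closureD X Y (P : {linear X -> Y} -> Prop) u v :
  add_closure P u -> add_closure P v -> add_closure P (u \+ v : {linear X -> Y}).
Proof.
move=> Pu Pv; elim: Pu => [|w w' Pw _ IH].
  have -> // : \0 \+ v = v :> {linear X -> Y}.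
  by apply: linear_ext => x /=; rewrite add0r.
have -> : (w \+ w') \+ v = w \+ (w' \+ v) :> {linear X -> Y}.
  by apply: linear_ext => x /=; rewrite addrA.
exact: add_closureS.
Qed.

Lemma add_closure_bind X Y (P Q : {linear X -> Y} -> Prop) u :
  (forall v, P v -> add_closure Q v) -> add_closure P u -> add_closure Q u.
Proof.
move=> PQ; elim=> [|v w Pv _ IH]; first exact: add_closure0.
by apply: add_closureD IH; apply: PQ.
Qed.

Lemma add_closure_comp X Y Z (P : {linear X -> Y} -> Prop)
    (Q : {linear Y -> Z} -> Prop) (T : {linear X -> Z} -> Prop) g h :
  (forall u v, P u -> Q v -> T (v \o u : {linear X -> Z})) ->
  add_closure P g -> add_closure Q h -> add_closure T (h \o g : {linear X -> Z}).
Proof.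
move=> PQT Pg Qh; elim: Pg => [|u u' Pu _ IH].
  by apply: add_closure_eq0 => x /=; rewrite linear0.
apply: (@add_closure_ext _ _ _ ((h \o u) \+ (h \o u') : {linear X -> Z})).
  by move=> x /=; rewrite linearD.
apply: add_closureD IH; elim: Qh => [|v v' Qv _ IH]; first exact: add_closure_eq0.
apply: (@add_closure_ext _ _ _ ((v \o u) \+ (v' \o u) : {linear X -> Z})) => //.
by apply: add_closureS => //; apply: PQT.
Qed.

Lemma sum_of_add_closure X Y (f : {linear X -> Y}) :
  add_closure (@irreducible_composition _ C X Y) f ->
  sum_of_irreducible_compositions C f.
Proof.
elim=> [|u v iu _ [n [w [iw vE]]]].
  by exists 0%N, (fun=> f); split=> [[]//|x]; rewrite big_ord0.
exists n.+1, (fun i => if unlift ord0 i is Some j then w j else u).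
split=> [i|x]; first by case: unliftP.
rewrite big_ord_recl /= unlift_none vE; congr (_ + _).
by apply: eq_bigr => i _; rewrite liftK.
Qed.

(** * Refinement of non-isomorphisms into irreducible morphisms *)

Section Factorization.
Local Open Scope classical_set_scope.
Hypothesis C_summand : closed_under_summands C.
Hypothesis C_length : forall X, C X -> finite_length_module X.

Lemma inl_linear X Y : linear (fun x : X => (x, 0) : (X * Y)%type).
Proof. by move=> a x y; congr pair; rewrite /= scaler0 addr0. Qed.

Lemma inr_linear X Y : linear (fun y : Y => (0, y) : (X * Y)%type).
Proof. by move=> a x y; congr pair; rewrite /= scaler0 addr0. Qed.

Lemma chain_retraction X Z (r : {linear Z -> X}) n z :
  retraction r -> r z = 0 -> z <> 0 ->
  chain [set (0 : X)] n setT -> chain [set (0 : Z)] n.+1 setT.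
Proof.
move=> [s rs] rz0 z0 c; apply: (@chain_noninj _ _ _ r _ n z) => //.
by apply: chain_sub c => // x _; exists (s x).
Qed.

(** Induction on a bound for the length of [Z]. If [Z] is indecomposable, [g] and [h] are themselves
    non-isomorphisms; if it splits, [h \o g] is the sum of its parts through the two shorter
    summands. *)
Lemma factor_noniso_path2 X Y Z (g : {linear X -> Z}) (h : {linear Z -> Y}) :
  ind C X -> ind C Y -> C Z -> ~ section g -> ~ retraction h ->
  add_closure (@noniso_path 2 X Y) (h \o g : {linear X -> Y}).
Proof.
move=> iX iY CZ; have [n] := C_length CZ.
elim: n Z g h CZ => [|n IHn] Z g h CZ nc ng nh; first by case: nc.
have [Z0|Z0] := pselect (zero_module Z).
  by apply: add_closure_eq0 => x /=; rewrite [g x]Z0 linear0.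
have [indZ|ndZ] := pselect (indecomposable Z).
  apply/add_closure_incl/noniso_path_cons => //.
    by move=> [k [kK _]]; apply: ng; exists k.
  by apply: noniso_path1 => // -[k [_ kK]]; apply: nh; exists k.
have [U [V [[u [v [uK vK]]] U0 V0]]] : exists U V : lmodType S,
    [/\ isomorphic Z (U * V)%type, ~ zero_module U & ~ zero_module V].
  apply: contrapT => nUV; apply: ndZ; split=> // U V ZUV.
  by apply: contrapT => /not_orP[U0 V0]; apply: nUV; exists U, V.
have ZUV : isomorphic Z (U * V)%type by exists u, v.
have v0 z : v z = 0 -> z = 0 by move=> vz; rewrite -[z]vK vz linear0.
pose iU : {linear U -> Z} := v \o mk_linear (@inl_linear U V).
pose iV : {linear V -> Z} := v \o mk_linear (@inr_linear U V).
pose pU : {linear Z -> U} := fst \o u.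
pose pV : {linear Z -> V} := snd \o u.
have iUK x : pU (iU x) = x by rewrite /pU /iU /= vK.
have iVK y : pV (iV y) = y by rewrite /pV /iV /= vK.
have pUiV y : pU (iV y) = 0 by rewrite /pU /iV /= vK.
have pViU x : pV (iU x) = 0 by rewrite /pV /iU /= vK.
have sumUV z : z = iU (pU z) + iV (pV z).
  rewrite /iU /iV /pU /pV /= -linearD -[LHS]uK; congr (v _).
  by case: (u z) => x y; congr pair; rewrite /= ?addr0 ?add0r.
(* The nonzero [z] killed by [p] makes [W] shorter than [Z]. If [p \o g] were a section so would be
   [g], and if [h \o i] were a retraction so would be [h]. *)
have part (W : lmodType S) (i : {linear W -> Z}) (p : {linear Z -> W}) z : C W ->
    (forall w, p (i w) = w) -> p z = 0 -> z <> 0 ->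
    add_closure (@noniso_path 2 X Y) ((h \o i) \o (p \o g) : {linear X -> Y}).
  move=> CW ip pz z0; apply: IHn => //.
  - by move=> c; apply: nc; apply: (chain_retraction _ pz z0 c); exists i.
  - by move=> [r rpg]; apply: ng; exists (r \o p).
  - by move=> [s his]; apply: nh; exists (i \o s).
have iU0 x : x <> 0 -> iU x <> 0 by move=> x0 ix0; apply: x0; rewrite -[x]iUK ix0 linear0.
have iV0 y : y <> 0 -> iV y <> 0 by move=> y0 iy0; apply: y0; rewrite -[y]iVK iy0 linear0.
have /existsNP[x0 x0N] := U0; have /existsNP[y0 y0N] := V0.
apply: (@add_closure_ext _ _ _
    (((h \o iU) \o (pU \o g)) \+ ((h \o iV) \o (pV \o g)) : {linear X -> Y})).
  by move=> x /=; rewrite -linearD -sumUV.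
apply: add_closureD.
  apply: (part _ _ _ (iV y0)) => //; last exact: iV0.
  by apply: C_summand CZ; exists V.
apply: (part _ _ _ (iU x0)) => //; last exact: iU0.
apply: C_summand CZ; exists U; exists (mk_linear (pair_linear pV pU)).
apply: bijective_isomorphism => [z z' /= [Vz Uz]|[y x]].
  by rewrite [z]sumUV [z']sumUV /pU /pV /= Vz Uz.
exists (iU x + iV y); rewrite [LHS]/=; congr pair.
  by rewrite -[LHS]/(pV _) linearD pViU iVK add0r.
by rewrite -[LHS]/(pU _) linearD pUiV iUK addr0.
Qed.

(** Between indecomposables sections and retractions are isomorphisms, so [f] can only fail to be
    irreducible through a factorisation as in [factor_noniso_path2]. *)
Lemma noniso_irreducible_or_path2 X Y (f : {linear X -> Y}) :
  ind C X -> ind C Y -> ~ isomorphism f ->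
  irreducible C f \/ add_closure (@noniso_path 2 X Y) f.
Proof.
move=> iX iY nf.
have [CX [X0 indX]] := iX; have [CY [Y0 indY]] := iY.
have nsec : ~ section f.
  by move=> [r rf]; apply: nf; exists r; split=> //; apply: split_mono_isomorphism.
have nret : ~ retraction f.
  by move=> [s fs]; apply: nf; exists s; split=> //; apply: split_mono_isomorphism.
apply: contrapT => /not_orP[nirr npath]; apply: nirr; split=> // Z g h CZ fE.
apply: contrapT => /not_orP[nh ng]; apply: npath.
have -> : f = h \o g :> {linear X -> Y} by exact: linear_ext.
exact: factor_noniso_path2.
Qed.

(** Either some factor is reducible and splits into paths of length two, or all are irreducible. The
    second case is phrased by precomposition because a path of length zero is an identity, which is
    not a composition of irreducible morphisms. *)
Lemma noniso_path_precomp n Y Z (h : {linear Y -> Z}) : noniso_path n h ->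
  add_closure (@noniso_path n.+1 Y Z) h \/
  forall X (g : {linear X -> Y}), ind C X -> irreducible C g ->
    irreducible_composition C (h \o g : {linear X -> Z}).
Proof.
elim=> [U iU|m U V W g k iU ng pk [IHk|IHk]].
- right=> X g iX ig.
  have -> : idfun \o g = g :> {linear X -> U} by exact: linear_ext.
  exact: irrcomp_single.
- left; apply: (@add_closure_comp _ _ _ (@noniso_path 1 U V) (@noniso_path m.+1 V W)) => //.
    by move=> u v; apply: noniso_path_cat.
  by apply/add_closure_incl/noniso_path1 => //; case: (noniso_path_ends pk).
- have iV : ind C V by case: (noniso_path_ends pk).
  have [ig|pg] := noniso_irreducible_or_path2 iU iV ng; last first.
    left; apply: (@add_closure_comp _ _ _ (@noniso_path 2 U V) (@noniso_path m V W)) => //.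
      by move=> u v; apply: noniso_path_cat.
    exact: add_closure_incl.
  by right=> X l iX il; apply: irrcomp_comp => //; apply: IHk.
Qed.

Lemma noniso_path_irreducible n X Z (f : {linear X -> Z}) : noniso_path n.+1 f ->
  irreducible_composition C f \/ add_closure (@noniso_path n.+2 X Z) f.
Proof.
move=> pf; have [Y [g [h [-> pg ph]]]] := noniso_path_split pf (esym (add1n n)).
have [iX iY] := noniso_path_ends pg; have ng := noniso_path_noniso pg.
have [{}ph|hirr] := noniso_path_precomp ph.
  right; apply: (@add_closure_comp _ _ _ (@noniso_path 1 X Y) (@noniso_path n.+1 Y Z)) => //.
    by move=> u v; apply: noniso_path_cat.
  exact: add_closure_incl.
have [ig|pg2] := noniso_irreducible_or_path2 iX iY ng; first by left; apply: hirr.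
right; apply: (@add_closure_comp _ _ _ (@noniso_path 2 X Y) (@noniso_path n Y Z)) => //.
  by move=> u v; apply: noniso_path_cat.
exact: add_closure_incl.
Qed.

Lemma noniso_sum_of_irreducible_compositions b X Y (f : {linear X -> Y}) :
  (forall X, ind C X -> ~ chain [set (0 : X)] b setT) ->
  ind C X -> ind C Y -> ~ isomorphism f ->
  sum_of_irreducible_compositions C f.
Proof.
move=> b_bound iX iY nf; apply: sum_of_add_closure.
(* Here [t] bounds the number of lengthenings left before the Harada-Sai bound is reached and the
   path vanishes. *)
suff path_irr t n (g : {linear X -> Y}) : ((2 ^ b.-1).-1 <= n.+1 + t)%N ->
    noniso_path n.+1 g -> add_closure (@irreducible_composition _ C X Y) g.
  exact: path_irr (leq_addl _ _) (noniso_path1 iX iY nf).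
elim: t n g => [|t IHt] n g nt pg.
  by apply: add_closure_eq0 => x; apply: harada_sai b_bound _ _ _ _ pg _ x; rewrite -[n.+1]addn0.
have [|{}pg] := noniso_path_irreducible pg; first exact: add_closure_incl.
by apply: add_closure_bind pg => v; apply: IHt; rewrite addSnnS.
Qed.

Lemma finite_representation_type_length_bound : finite_representation_type C ->
  exists b, forall X, ind C X -> ~ chain [set (0 : X)] b setT.
Proof.
move=> [n [F [iF Fall]]].
have [l lP] := choice (fun i => C_length (iF i).1).
exists (\sum_i l i)%N => X /Fall[i [u [v [uK _]]]] c; apply: (lP i).
apply: (@chain_surj _ _ _ v _ _ (@submoduleT _ _)); apply: chainW (chain_sub (@subset_refl _ _) _ c).
  by rewrite (bigD1 i) //= leq_addr.
by move=> x _; exists (u x).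
Qed.

End Factorization.

(** If [g] were inverse to [f], the map [1 - g f = 0] would be an automorphism of the nonzero
    [X]. *)
Lemma radical_noniso X Y (f : {linear X -> Y}) :
  ~ zero_module X -> radical C f -> ~ isomorphism f.
Proof.
move=> X0 [_ _ rf] [g [gK _]]; apply: X0 => x; have [v [vK _]] := rf g.
by rewrite -[x]vK /= gK subrr linear0.
Qed.

End Paths.

Unset Implicit Arguments.

Theorem theoremD (R : comNzRingType) (L : algType R)
    (C : lmodType L -> Prop) (A B : lmodType L) (f : {linear A -> B}) :
  artin_algebra L ->
  additive_subcategory C ->
  closed_under_isomorphisms C ->
  closed_under_summands C ->
  functorially_finite C ->
  C L^o \/ (exists2 I : lmodType R, envelope_of_R_mod_J I & C (dual L I)) ->
  ind C A -> ind C B ->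
  radical C f ->
  (exists x, f x <> 0) ->
  finite_representation_type C ->
  sum_of_irreducible_compositions C f.
Proof.
move=> artL [C_fg _ _] _ C_summand _ _ indA indB radf _ C_fin.
have C_length X : C X -> finite_length_module X.
  by move=> /C_fg; apply: artin_algebra_finite_length.
have [b b_bound] := finite_representation_type_length_bound C_length C_fin.
apply: noniso_sum_of_irreducible_compositions b_bound _ _ _ => //.
by apply: radical_noniso radf; case: indA => _ [].
Qed.
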